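(* Let $E_1|H_1,\ldots,E_{n+1}|H_{n+1}$ be $n+1$ arbitrary conditional events, with $n\geq 1$. Then the disjunctions $\mathcal{D}_n=\bigvee_{i=1}^n(E_i|H_i)$ and $\mathcal{D}_{n+1}=\bigvee_{i=1}^{n+1}(E_i|H_i)$ satisfy $\mathcal{D}_{n+1}\geq\mathcal{D}_n$.
   Context: Events are two-valued propositions (identified with subsets of the sure event $\Omega$, and with their indicators); $\overline{A}$ is negation, $AB$ is conjunction. For events $E,H$ with $H\neq\emptyset$, the conditional event $E|H$ is true if $EH$ is true, false if $\overline{E}H$ is true, void if $\overline{H}$ is true. A conditional random quantity $X|H$ ($X$ with finitely many values, $H\ne\emptyset$) with assessed prevision $\mu=\mathbb{P}(X|H)$ is identified with the random quantity $XH+\mu\overline{H}$; in particular $E|H=EH+x\overline{H}$ with $x=P(E|H)$. Coherence: an assessment of previsions $\mu_j=\mathbb{P}(X_j|K_j)$ on a family of conditional random quantities is coherent if, for every finite subfamily $\{X_1|K_1,\ldots,X_r|K_r\}$ and all real $s_1,\ldots,s_r$, the gain $G=\sum_j s_jK_j(X_j-\mu_j)$ restricted to $K_1\vee\cdots\vee K_r$ satisfies $\min G\leq 0\leq\max G$. Disjunction. Given conditional events $E_1|H_1,\ldots,E_N|H_N$, for each nonempty $S\subseteq\{1,\ldots,N\}$ let $y_S$ be the assessed prevision of $\mathcal{D}_S=\bigvee_{i\in S}(E_i|H_i)$ ($y_{\{i\}}=P(E_i|H_i)$). $\mathcal{D}_S$ is the random quantity, conditional on $\bigvee_{i\in S}H_i$,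 with value $1$ if at least one $E_i|H_i$, $i\in S$, is true; $0$ if all are false; $y_V$ if none is true and the set $V\subseteq S$ of indices of void ones is nonempty (so its value is its prevision $y_S$ when all $H_i$, $i\in S$, are false). Convention: the numbers $y_S$ always form a coherent assessment on the family of all $\mathcal{D}_S$, and inequalities between compounds are pointwise inequalities of random quantities on $\Omega$, for every such coherent assessment. *)

(* Defs.v *)
From HB Require Import structures.
From mathcomp Require Import all_boot all_order all_algebra.
From mathcomp Require Import boolp classical_sets functions cardinality reals numfun.
Set Implicit Arguments.
Unset Strict Implicit.
Unset Printing Implicit Defensive.
Import Order.TTheory GRing.Theory Num.Theory.
Local Open Scope classical_set_scope.
Local Open Scope ring_scope.

(* Events are arbitrary subsets of the sure event Omega. *)
Record cond_event (Omega : Type) := CondEvent {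
  ce_event : set Omega;
  ce_cond : set Omega;
  ce_cond_neq0 : ce_cond !=set0 }.

Definition ce_true (Omega : Type) (A : cond_event Omega) : set Omega :=
  ce_event A `&` ce_cond A.
Definition ce_void (Omega : Type) (A : cond_event Omega) : set Omega :=
  ~` ce_cond A.

Record cond_rq (R : realType) (Omega : Type) := CondRQ {
  rq_val : Omega -> R;
  rq_cond : set Omega;
  rq_finite : finite_set (range rq_val);
  rq_cond_neq0 : rq_cond !=set0 }.

(* The random quantity X H + mu (not H) with which X|H is identified once its
   prevision mu has been assessed. *)
Definition as_rq (R : realType) (Omega : Type) (Q : cond_rq R Omega) (mu : R)
    (w : Omega) : R :=
  rq_val Q w * \1_(rq_cond Q) w + mu * \1_(~` rq_cond Q) w.

Definition gain (R : realType) (Omega : Type) (I : eqType)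
    (Q : I -> cond_rq R Omega) (mu : I -> R) (J : seq I) (s : I -> R)
    (w : Omega) : R :=
  \sum_(j <- J) s j * \1_(rq_cond (Q j)) w * (rq_val (Q j) w - mu j).

Definition coherent (R : realType) (Omega : Type) (I : eqType)
    (Q : I -> cond_rq R Omega) (mu : I -> R) : Prop :=
  forall (J : seq I) (s : I -> R), J != [::] -> uniq J ->
  let values := gain Q mu J s @` \bigcup_(j in [set` J]) rq_cond (Q j) in
  exists m M : R, [/\ values m, lbound values m, values M, ubound values M
    & m <= 0 <= M].

(* finset.set0 is the empty finite set; the bare set0 is the one of
   classical_sets. *)
Notation neset N := {S : {set 'I_N} | S != finset.set0}.

Definition void_in (Omega : Type) (N : nat) (A : 'I_N -> cond_event Omega)
    (S : {set 'I_N}) (w : Omega) : {set 'I_N} :=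
  [set i in S | w \in ce_void (A i)]%SET.

(* If no member is true and none is void, then all of them are false. The value
   y finset.set0 is never used. *)
Definition disj_val (R : realType) (Omega : Type) (N : nat)
    (A : 'I_N -> cond_event Omega) (y : {set 'I_N} -> R) (S : {set 'I_N})
    (w : Omega) : R :=
  if [exists i in S, w \in ce_true (A i)] then 1
  else if void_in A S w == finset.set0 then 0
  else y (void_in A S w).

Lemma disj_val_finite (R : realType) (Omega : Type) (N : nat)
    (A : 'I_N -> cond_event Omega) (y : {set 'I_N} -> R) (S : {set 'I_N}) :
  finite_set (range (disj_val A y S)).
Proof.
apply: (@sub_finite_set _ _ ([set 1; 0] `|` range y)); last first.
  rewrite finite_setU; split; first exact: finite_set2.
  exact/finite_image/finite_finset.
move=> _ [w _ <-]; rewrite /disj_val.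
case: ifP => _; first by left; left.
case: ifP => _; first by left; right.
by right; exists (void_in A S w).
Qed.

Lemma disj_cond_neq0 (Omega : Type) (N : nat)
    (A : 'I_N -> cond_event Omega) (S : neset N) :
  \bigcup_(i in [set` val S]) ce_cond (A i) !=set0.
Proof.
case: S => S /= /finset.set0Pn[i iS].
by have [w Hw] := ce_cond_neq0 (A i); exists w, i.
Qed.

Definition disj (R : realType) (Omega : Type) (N : nat)
    (A : 'I_N -> cond_event Omega) (y : {set 'I_N} -> R) (S : neset N) :
    cond_rq R Omega :=
  CondRQ (disj_val_finite A y (val S)) (disj_cond_neq0 A S).

Definition disj_rq (R : realType) (Omega : Type) (N : nat)
    (A : 'I_N -> cond_event Omega) (y : {set 'I_N} -> R) (S : neset N) :
    Omega -> R :=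
  as_rq (disj A y S) (y (val S)).

Definition disj_coherent (R : realType) (Omega : Type) (N : nat)
    (A : 'I_N -> cond_event Omega) (y : {set 'I_N} -> R) : Prop :=
  coherent (disj A y) (fun S : neset N => y (val S)).

Lemma first_neq0 (n : nat) (hn : (1 <= n)%N) :
  [set i : 'I_n.+1 | (i < n)%N]%SET != finset.set0.
Proof. by apply/finset.set0Pn; exists ord0; rewrite finset.inE. Qed.

Definition first_indices (n : nat) (hn : (1 <= n)%N) : neset n.+1 :=
  exist _ [set i : 'I_n.+1 | (i < n)%N]%SET (first_neq0 hn).

Lemma all_neq0 (n : nat) : [set: 'I_n.+1]%SET != finset.set0.
Proof. by apply/finset.set0Pn; exists ord0; rewrite finset.inE. Qed.

Definition all_indices (n : nat) : neset n.+1 :=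
  exist _ [set: 'I_n.+1]%SET (all_neq0 n).

(* Main.v *)
Require Import Defs.
From mathcomp Require Import all_boot all_order all_algebra.
From mathcomp Require Import boolp classical_sets functions cardinality reals numfun.
Import Order.TTheory GRing.Theory Num.Theory.
Local Open Scope ring_scope.

(** Give the empty disjunction the prevision 0.  Then at every [w] at which no
    [E_i|H_i], [i] in [S], is true, [D_S] takes the value [y_V], where [V] is
    the set of void indices in [S]: the values none void ([V] empty, value 0)
    and all void ([V = S], value [y_S]) are no longer exceptional.  From this
    uniform description, [D_S <= D_T] at [w] for [S] included in [T] as soon
    as [y_V <= 1] and [y_V <= y_W], where [V] and [W] are the void indices of
    [S] and [T], so that [V] is included in [W] ([compound_le]).

    It remains to see that the previsions are at most 1 and increase with the
    index set.  Both follow by induction on the size of the larger index set.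
    Staking 1 on [D_T] and -1 on [D_S] yields the gain
    [(D_T - y_T) - (D_S - y_S)], which coherence forces to be nonpositive at
    some [w] at which the bet is not called off, that is, at which some [H_i],
    [i] in [T], holds ([coherent_bet]).  At such a [w] the set [W] is strictly
    smaller than [T], so the induction hypothesis gives
    [D_S(w) <= D_T(w)], and therefore [y_S <= y_T] ([prevision_mono]).
    Staking -1 on [D_S] alone bounds [y_S] by 1 in the same way
    ([prevision_le1]). *)

Section Compound.
Variables (R : realType) (Omega : Type) (N : nat).
Variables (A : 'I_N -> cond_event Omega) (y : {set 'I_N} -> R).
Implicit Types (S T : {set 'I_N}) (w : Omega).

(** With the value 0 at the empty set, [prevision (void_in A S w)] is also the
    value of [D_S] where all its members are false. *)
Definition prevision S : R := if S == finset.set0 then 0 else y S.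

(** This is [D_S] as a random quantity on the whole of [Omega] ([disj_rqE]): it
    takes the value [y_S] where all members are void, since [void_in A S w] is
    then [S]. *)
Definition compound S w : R :=
  if [exists i in S, w \in ce_true (A i)] then 1
  else prevision (void_in A S w).

Lemma void_inS S T w : S \subset T -> void_in A S w \subset void_in A T w.
Proof.
move=> sST; apply/fintype.subsetP => i; rewrite !finset.inE => /andP[iS ->].
by rewrite (fintype.subsetP sST).
Qed.

(** This is the descent step of both inductions below: where a bet on [D_S] is
    in force, the value of [D_S] only involves previsions of smaller
    disjunctions. *)
Lemma void_in_ltn S w i :
  i \in S -> ce_cond (A i) w -> (#|void_in A S w| < #|S|)%N.
Proof.
move=> iS Hi; apply: proper_card; apply/properP; split.
  by apply/fintype.subsetP => j; rewrite !finset.inE => /andP[].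
exists i => //; rewrite !finset.inE iS /=; apply/negP.
by rewrite in_setE => /(_ Hi).
Qed.

(** Passing from [S] to [T] only enlarges the sets of true and of void indices.
    The bound by 1 serves where a member of [T] is true but none of [S] is. *)
Lemma compound_le S T w : S \subset T ->
  prevision (void_in A S w) <= 1 ->
  prevision (void_in A S w) <= prevision (void_in A T w) ->
  compound S w <= compound T w.
Proof.
move=> sST le1S leST; rewrite /compound.
case: existsP => [[i /andP[iS Ti]]|_]; last by case: ifP.
case: existsP => // -[]; exists i.
by rewrite (fintype.subsetP sST _ iS).
Qed.

Lemma compound_void S w : S != finset.set0 ->
  (forall i, i \in S -> ~ ce_cond (A i) w) -> compound S w = y S.
Proof.
move=> S0 nH; rewrite /compound /prevision.
have -> : void_in A S w = S.
  apply/setP => i; rewrite finset.inE; case: (boolP (i \in S)) => //= iS.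
  by apply: mem_set; exact: nH.
case: existsP => [[i /andP[iS]]|_]; last by rewrite (negbTE S0).
by rewrite in_setE => -[_ /(nH _ iS)].
Qed.

Lemma disj_rqE (U : neset N) w : disj_rq A y U w = compound (val U) w.
Proof.
rewrite /disj_rq /as_rq /= !indicE in_setC.
case: (boolP (w \in _)) => /= [_|]; first by rewrite mulr1 mulr0 addr0.
move=> nK; rewrite mulr0 mulr1 add0r compound_void ?(valP U)// => i iS Hi.
by move/negP: nK; apply; rewrite in_setE; exists i.
Qed.

(** Where a bet on [D_U] is called off, [D_U] equals its prevision, so the
    corresponding term of the gain vanishes even without the indicator. *)
Lemma gain_disj (J : seq (neset N)) (s : neset N -> R) w :
  gain (disj A y) (fun U => y (val U)) J s w =
  \sum_(U <- J) s U * (compound (val U) w - y (val U)).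
Proof.
apply: eq_bigr => U _; rewrite -disj_rqE /disj_rq /as_rq !indicE in_setC.
by case: (w \in _); rewrite /= ?mulr1 ?mulr0 ?mul0r ?addr0 ?add0r ?subrr ?mulr0.
Qed.

Section Coherent.
Hypothesis coh : disj_coherent A y.

(** The minimum of the gain is attained and nonpositive: coherence excludes a
    sure gain. *)
Lemma coherent_gain (J : seq (neset N)) (s : neset N -> R) :
  J != [::] -> uniq J ->
  exists w, [/\ exists i, (exists2 U, U \in J & i \in val U) /\ ce_cond (A i) w
    & \sum_(U <- J) s U * (compound (val U) w - y (val U)) <= 0].
Proof.
move=> J0 uJ; have [m [_ [[w [U UJ [i iS Hi]] <-] _ _ _ /andP[le0 _]]]] :=
  coh J s J0 uJ.
exists w; split; last by rewrite -gain_disj.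
by exists i; split=> //; exists U.
Qed.

(** Staking -1 on [D_S] shows that [y_S] is at most some value of [D_S] taken
    where the bet is in force; such a value is 1 or the prevision of a smaller
    disjunction. *)
Lemma prevision_le1 S : prevision S <= 1.
Proof.
have [m] := ubnP #|S|; elim: m S => // m IH S leSm.
rewrite /prevision; case: (boolP (S == _)) => [_|S0]; first exact: ler01.
pose S' : neset N := exist _ S S0.
have [w [[i [[_ /[!inE]/eqP-> /= iS] Hi]]]] :=
  @coherent_gain [:: S'] (fun=> -1) isT isT.
rewrite big_seq1 mulN1r oppr_le0 subr_ge0 => /le_trans; apply.
rewrite /compound; case: ifP => // _; apply: IH.
exact: leq_trans (void_in_ltn _ _ _ iS Hi) leSm.
Qed.

(** There is no sure gain in staking 1 on [D_T] and -1 on [D_S].  Allowing [S]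
    empty makes nonnegativity of the previsions a case of monotonicity. *)
Lemma coherent_bet S T : S \subset T -> S != T ->
  exists w, [/\ exists2 i, i \in T & ce_cond (A i) w
    & compound T w - prevision T <= compound S w - prevision S].
Proof.
move=> sST neST; have T0 : T != finset.set0.
  by apply: contraNneq neST => T0; move: sST; rewrite T0 finset.subset0.
pose T' : neset N := exist _ T T0.
have [S0|S0] := eqVneq S finset.set0.
  (* The empty disjunction is constantly 0: only [D_T] is bet on. *)
  have [w [[i [[_ /[!inE]/eqP-> /= iT] Hi]]]] :=
    @coherent_gain [:: T'] (fun=> 1) isT isT.
  rewrite big_seq1 mul1r => le0; exists w; split; first by exists i.
  have -> : compound S w = prevision S.
    rewrite /compound; case: existsP => [[j]|_]; first by rewrite S0 finset.inE.
    by congr prevision; apply/setP => j; rewrite S0 !finset.inE.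
  by rewrite subrr /prevision (negbTE T0).
pose S' : neset N := exist _ S S0.
have neST' : S' != T' by [].
have uST : uniq [:: T'; S'] by rewrite /= inE eq_sym neST'.
have [w [[i [[U UJ iU] Hi]]]] :=
  @coherent_gain [:: T'; S'] (fun U => if U == T' then 1 else -1) isT uST.
rewrite big_cons big_seq1 eqxx (negbTE neST') mul1r mulN1r subr_le0 /= => le0.
exists w; split; last by rewrite /prevision (negbTE T0) (negbTE S0).
exists i => //; move: UJ iU; rewrite !inE => /orP[]/eqP-> //=.
exact: (fintype.subsetP sST).
Qed.

(** At the [w] given by [coherent_bet], [D_S <= D_T] by induction, because some
    [H_i], [i] in [T], holds and so the void indices of [T] do not exhaust [T];
    the nonpositive gain then orders the previsions. *)
Lemma prevision_mono S T : S \subset T -> prevision S <= prevision T.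
Proof.
have [m] := ubnP #|T|; elim: m S T => // m IH S T leTm sST.
have [->//|neST] := eqVneq S T.
have [w [[i iT Hi] lew]] := coherent_bet _ _ sST neST.
have leD : compound S w <= compound T w.
  apply: compound_le => //; rewrite ?prevision_le1//; apply: IH.
    exact: leq_trans (void_in_ltn _ _ _ iT Hi) leTm.
  exact: void_inS.
by have := le_trans lew (lerD leD (lexx _)); rewrite lerD2l lerN2.
Qed.

Lemma compound_mono S T w : S \subset T -> compound S w <= compound T w.
Proof.
move=> sST; apply: compound_le; rewrite ?prevision_le1//.
exact/prevision_mono/void_inS.
Qed.

End Coherent.
End Compound.

Theorem theorem8 (R : realType) (Omega : Type) (n : nat) (hn : (1 <= n)%N)
    (A : 'I_n.+1 -> cond_event Omega) (y : {set 'I_n.+1} -> R) :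
  disj_coherent A y ->
  forall w : Omega,
    disj_rq A y (first_indices hn) w <= disj_rq A y (all_indices n) w.
Proof.
by move=> coh w; rewrite !disj_rqE; apply: compound_mono => //; exact: finset.subsetT.
Qed.
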